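(* Let $\Bbbk$ be a field and $(H,\mu,u,\Delta,\varepsilon,S)$ a Hopf $\Bbbk$-algebra. Any partial $H$-module $(M,\lambda)$, with $\lambda(h\otimes m)=h\cdot m$, can be endowed with a structure $(M,H\bullet M,\pi_M,\rho_M)$ of geometric partial comodule over the coalgebra $(H,\mu,u)$ in the abelian monoidal category $\mathsf{Vect}_\Bbbk^{\mathrm{op}}$, with $$H\bullet M=\Big\{\sum_i h_i\otimes m_i\in H\otimes M\ \Big|\ \sum_i k\cdot(h_i\cdot m_i)=\sum_i kh_i\cdot m_i\ \text{ for all } k\in H\Big\},$$ where (as linear maps) $\pi_M:H\bullet M\to H\otimes M$ is the inclusion and $\rho_M:H\bullet M\to M$ is the restriction of $\lambda$. This induces a faithful functor $$\mathcal P:\mathsf{PMod}_H\to\left(\mathsf{gPCom}^H\right)^{\mathrm{op}}$$ (from the category of partial $H$-modules to the opposite of the category of geometric partial comodules over $H$ in $\mathsf{Vect}_\Bbbk^{\mathrm{op}}$).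
   Context: A (left) partial $H$-module is a vector space $M$ with a linear map $\lambda:H\otimes M\to M$, $h\otimes m\mapsto h\cdot m$, such that for all $m\in M$, $h,k\in H$ (Sweedler notation): (1) $1_H\cdot m=m$; (2) $h\cdot(k_{(1)}\cdot(S(k_{(2)})\cdot m))=(hk_{(1)})\cdot(S(k_{(2)})\cdot m)$; (3) $k_{(1)}\cdot(S(k_{(2)})\cdot(h\cdot m))=k_{(1)}\cdot(S(k_{(2)})h\cdot m)$. Morphisms are linear maps $f$ with $f(h\cdot m)=h\cdot' f(m)$; this is the category $\mathsf{PMod}_H$. Geometric partial comodules over $(H,\mu,u)$ in $\mathsf{Vect}_\Bbbk^{\mathrm{op}}$, with $H$ acting on the left, spelled out in $\mathsf{Vect}_\Bbbk$: a quadruple $(M,H\bullet M,\pi_M,\rho_M)$ with $\pi_M:H\bullet M\to H\otimes M$ an injective linear map and $\rho_M:H\bullet M\to M$ a linear map. Let $H\bullet(H\bullet M)$, with projections $H\bullet\rho_M$ to $H\bullet M$ and $\pi_{H\bullet M}$ to $H\otimes(H\bullet M)$, be the pullback of $\pi_M:H\bullet M\to H\otimes M$ and $H\otimes\rho_M:H\otimes(H\bullet M)\to H\otimes M$. Let $(H\bullet H)\bullet M$, with projections $\mu\bullet M$ to $H\bullet M$ and $\pi_{\mu,M}$ to $H\otimes (H\bullet M)$, be the pullback of $\pi_M$ and $(\mu\otimes M)\circ(H\otimes\pi_M)$. The axioms are: (unitality) there is a linear map $u\bullet M:M\to H\bullet M$ with $\rho_M\circ(u\bullet M)=\mathrm{Id}_M$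 and $\pi_M((u\bullet M)(m))=1_H\otimes m$; (geometric associativity) there is an isomorphism $\theta:H\bullet(H\bullet M)\to(H\bullet H)\bullet M$ with $\pi_{\mu,M}\circ\theta=\pi_{H\bullet M}$ and $\rho_M\circ(\mu\bullet M)\circ\theta=\rho_M\circ(H\bullet\rho_M)$. In $(\mathsf{gPCom}^H)^{\mathrm{op}}$ a morphism $M\to M'$ is a pair of linear maps $f:M\to M'$ and $H\bullet f:H\bullet M\to H\bullet M'$ with $f\circ\rho_M=\rho_{M'}\circ(H\bullet f)$ and $(H\otimes f)\circ\pi_M=\pi_{M'}\circ(H\bullet f)$. The functor $\mathcal P$ sends $(M,\lambda)$ to the geometric partial comodule described in the claim and a morphism $f$ to $(f,H\bullet f)$, with $H\bullet f$ the map induced by $H\otimes f$. *)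

(* Defs.v *)
From HB Require Import structures.
From mathcomp Require Import all_boot all_order all_algebra.
From mathcomp Require Import boolp.

Set Implicit Arguments.
Unset Strict Implicit.
Unset Printing Implicit Defensive.

Import GRing.Theory.
Local Open Scope ring_scope.
Local Open Scope quotient_scope.

Lemma linear_eq (K : fieldType) (U V : lmodType K) (f g : {linear U -> V}) :
  f =1 g -> f = g.
Proof.
move=> /funext; case: f => f [cf1 cf2]; case: g => g [cg1 cg2] /= fg.
move: cf1 cf2 cg1 cg2; case: _ / fg => -[a] [b] [c] [d].
by rewrite (Prop_irrelevance a c) (Prop_irrelevance b d).
Qed.

Definition bilinear_map (K : fieldType) (U V W : lmodType K) (f : U -> V -> W) :=
  bilinear_for *:%R *:%R f.

(* Tensor products of arbitrary, possibly infinite-dimensional vector spaces.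
   A formal sum [:: (u_1, v_1); ...; (u_n, v_n)] stands for
   u_1 (x) v_1 + ... + u_n (x) v_n; the relation below is the congruence on the
   monoid of formal sums generated by commutativity and bilinearity. *)
Inductive tensor_rel (K : fieldType) (U V : lmodType K) :
    seq (U * V) -> seq (U * V) -> Prop :=
| TensorRefl s : tensor_rel s s
| TensorSym s t : tensor_rel s t -> tensor_rel t s
| TensorTrans s t r : tensor_rel s t -> tensor_rel t r -> tensor_rel s r
| TensorCat s s' t t' :
    tensor_rel s s' -> tensor_rel t t' -> tensor_rel (s ++ t) (s' ++ t')
| TensorComm s t : tensor_rel (s ++ t) (t ++ s)
| TensorZero v : tensor_rel [:: (0, v)] [::]
| TensorAddl u u' v : tensor_rel [:: (u + u', v)] [:: (u, v); (u', v)]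
| TensorAddr u v v' : tensor_rel [:: (u, v + v')] [:: (u, v); (u, v')]
| TensorScale (a : K) u v : tensor_rel [:: (a *: u, v)] [:: (u, a *: v)].

Arguments TensorZero {K U V}.
Arguments TensorRefl {K U V}.
Arguments TensorAddl {K U V}.
Arguments TensorAddr {K U V}.
Arguments TensorScale {K U V}.

Section Tensor.
Variables (K : fieldType) (U V : lmodType K).
Implicit Types (s t : seq (U * V)).

Definition tensor_equiv s t := `[< tensor_rel s t >].

Lemma tensor_equiv_refl : reflexive tensor_equiv.
Proof. by move=> s; apply/asboolP; exact: TensorRefl. Qed.
Lemma tensor_equiv_sym : symmetric tensor_equiv.
Proof. by move=> s t; apply/asboolP/asboolP; exact: TensorSym. Qed.
Lemma tensor_equiv_trans : transitive tensor_equiv.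
Proof.
by move=> s t r /asboolP ts /asboolP sr; apply/asboolP; exact: TensorTrans ts sr.
Qed.

Canonical tensor_equivRel := EquivRel tensor_equiv
  tensor_equiv_refl tensor_equiv_sym tensor_equiv_trans.

Definition tensor : Type := {eq_quot tensor_equivRel}.
HB.instance Definition _ := EqQuotient.on tensor.
HB.instance Definition _ := Choice.on tensor.

Definition tens_class s : tensor := \pi_tensor s.
Definition tens (u : U) (v : V) : tensor := tens_class [:: (u, v)].

Lemma tens_classP s t : tens_class s = tens_class t <-> tensor_rel s t.
Proof.
split; first by move/eqmodP/asboolP.
by move=> st; apply/eqmodP/asboolP.
Qed.

Lemma tens_classK (x : tensor) : tens_class (repr x) = x.
Proof. exact: reprK. Qed.

Definition scale_seq (a : K) s := [seq (a *: p.1, p.2) | p <- s].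

Lemma scale_seq_rel a s t :
  tensor_rel s t -> tensor_rel (scale_seq a s) (scale_seq a t).
Proof.
rewrite /scale_seq; elim=> {s t}.
- by move=> *; exact: TensorRefl.
- by move=> s t _ ?; exact: TensorSym.
- by move=> s t r _ st _ tr; exact: TensorTrans st tr.
- by move=> s s' t t' _ ? _ ?; rewrite !map_cat; exact: TensorCat.
- by move=> s t; rewrite !map_cat; exact: TensorComm.
- by move=> v /=; rewrite scaler0; exact: TensorZero.
- by move=> u u' v /=; rewrite scalerDr; exact: TensorAddl.
- by move=> u v v' /=; exact: TensorAddr.
- move=> b u v /=; rewrite scalerA mulrC -scalerA; exact: TensorScale.
Qed.

Definition tens_zero : tensor := tens_class [::].
Definition tens_add (x y : tensor) : tensor := tens_class (repr x ++ repr y).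
Definition tens_scale (a : K) (x : tensor) : tensor :=
  tens_class (scale_seq a (repr x)).
Definition tens_opp : tensor -> tensor := tens_scale (-1).

Lemma tens_class_repr s : tensor_rel (repr (tens_class s)) s.
Proof. by apply/tens_classP; rewrite tens_classK. Qed.

Lemma tens_addE s t :
  tens_add (tens_class s) (tens_class t) = tens_class (s ++ t).
Proof. by apply/tens_classP; apply: TensorCat; exact: tens_class_repr. Qed.

Lemma tens_scaleE a s : tens_scale a (tens_class s) = tens_class (scale_seq a s).
Proof. by apply/tens_classP/scale_seq_rel; exact: tens_class_repr. Qed.

Lemma tens_addA : associative tens_add.
Proof.
move=> x y z; rewrite -(tens_classK x) -(tens_classK y) -(tens_classK z).
by rewrite !tens_addE catA.
Qed.

Lemma tens_addC : commutative tens_add.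
Proof. by move=> x y; apply/tens_classP; exact: TensorComm. Qed.

Lemma tens_add0 : left_id tens_zero tens_add.
Proof. by move=> x; rewrite -(tens_classK x) tens_addE. Qed.

Lemma tens_scaleDr a : {morph tens_scale a : x y / tens_add x y}.
Proof.
move=> x y; rewrite -(tens_classK x) -(tens_classK y).
by rewrite !(tens_addE, tens_scaleE) /scale_seq map_cat.
Qed.

Lemma tens_scaleDl x :
  {morph tens_scale^~ x : a b / a + b >-> tens_add a b}.
Proof.
move=> a b; rewrite -(tens_classK x) !(tens_addE, tens_scaleE).
apply/tens_classP; elim: (repr x) => [|[u v] s IHs] /=; first exact: TensorRefl.
rewrite scalerDl.
apply: (TensorTrans (TensorCat (TensorAddl (a *: u) (b *: u) v) IHs)) => /=.
have h := TensorCat (TensorComm [:: (b *: u, v)] (scale_seq a s))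
                    (TensorRefl (scale_seq b s)).
by rewrite -!catA in h; exact: TensorCat (TensorRefl [:: (a *: u, v)]) h.
Qed.

Lemma tens_scale0 x : tens_scale 0 x = tens_zero.
Proof.
rewrite -(tens_classK x) tens_scaleE; apply/tens_classP.
elim: (repr x) => [|[u v] s IHs] /=; first exact: TensorRefl.
by rewrite scale0r; exact: (TensorCat (TensorZero v) IHs).
Qed.

Lemma tens_scale1 : left_id 1 tens_scale.
Proof.
move=> x; rewrite -(tens_classK x) tens_scaleE; congr tens_class.
by rewrite -[RHS]map_id; apply: eq_map => -[u v] /=; rewrite scale1r.
Qed.

Lemma tens_scaleA a b x : tens_scale a (tens_scale b x) = tens_scale (a * b) x.
Proof.
rewrite -(tens_classK x) !tens_scaleE /scale_seq -map_comp; congr tens_class.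
by apply: eq_map => -[u v] /=; rewrite scalerA.
Qed.

Lemma tens_addN : left_inverse tens_zero tens_opp tens_add.
Proof.
move=> x; rewrite -[X in tens_add _ X](tens_scale1 x) /tens_opp.
by rewrite -tens_scaleDl addNr tens_scale0.
Qed.

HB.instance Definition _ := GRing.isZmodule.Build tensor
  tens_addA tens_addC tens_add0 tens_addN.
HB.instance Definition _ := GRing.Zmodule_isLmodule.Build K tensor
  tens_scaleA tens_scale1 tens_scaleDr tens_scaleDl.

Lemma tens_sum (x : tensor) : x = \sum_(p <- repr x) tens p.1 p.2.
Proof.
rewrite -[LHS]tens_classK; elim: (repr x) => [|[u v] s IHs]; first by rewrite big_nil.
by rewrite big_cons -IHs -[RHS]/(tens_add _ _) tens_addE.
Qed.

Lemma tens_bilinear : bilinear_map tens.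
Proof.
split=> [v a u u'|u a v v']; rewrite -[RHS]/(tens_add (tens_scale _ _) _).
  rewrite tens_scaleE tens_addE; apply/tens_classP; exact: TensorAddl.
rewrite tens_scaleE tens_addE; apply/tens_classP.
apply: TensorTrans (TensorAddr _ _ _) _.
rewrite -[X in tensor_rel X _]cat1s.
exact: TensorCat (TensorSym (TensorScale _ _ _)) (TensorRefl _).
Qed.

(* tsum f x = f u_1 v_1 + ... + f u_n v_n, where u_1 (x) v_1 + ... + u_n (x) v_n
   is a chosen expression of x; for bilinear f the choice is irrelevant and
   tsum f is the linear map induced by f (tsumE, tsum_linear). *)
Definition tsum (W : zmodType) (f : U -> V -> W) (x : tensor) : W :=
  \sum_(p <- repr x) f p.1 p.2.

Section Universal.
Variables (W : lmodType K) (f : U -> V -> W).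
Hypothesis f_bilin : bilinear_map f.

Let f0l v : f 0 v = 0.
Proof. by have := f_bilin.1 v (-1) 0 0; rewrite /= scaler0 addr0 scaleN1r addNr. Qed.

Let fZl a u v : f (a *: u) v = a *: f u v.
Proof. by have := f_bilin.1 v a u 0; rewrite /= !addr0 f0l addr0. Qed.

Let fDl u u' v : f (u + u') v = f u v + f u' v.
Proof. by have := f_bilin.1 v 1 u u'; rewrite /= !scale1r. Qed.

Let fDr u v v' : f u (v + v') = f u v + f u v'.
Proof. by have := f_bilin.2 u 1 v v'; rewrite /= !scale1r. Qed.

Let fZr u a v : f u (a *: v) = a *: f u v.
Proof.
have f0r : f u 0 = 0.
  by have := f_bilin.2 u (-1) 0 0; rewrite /= scaler0 addr0 scaleN1r addNr.
by have := f_bilin.2 u a v 0; rewrite /= !addr0 f0r addr0.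
Qed.

Lemma tsum_rel s t : tensor_rel s t ->
  \sum_(p <- s) f p.1 p.2 = \sum_(p <- t) f p.1 p.2.
Proof.
elim=> {s t} //.
- by move=> s t r _ -> _ ->.
- by move=> s s' t t' _ ss' _ tt'; rewrite !big_cat ss' tt'.
- by move=> s t; rewrite !big_cat /= addrC.
- by move=> v; rewrite big_seq1 big_nil f0l.
- by move=> u u' v; rewrite !big_cons !big_nil !addr0 /= fDl.
- by move=> u v v'; rewrite !big_cons !big_nil !addr0 /= fDr.
- by move=> a u v; rewrite !big_cons !big_nil !addr0 /= fZl fZr.
Qed.

Lemma tsumE u v : tsum f (tens u v) = f u v.
Proof. by rewrite /tsum (tsum_rel (tens_class_repr _)) big_seq1. Qed.

Lemma tsum_linear : linear (tsum f).
Proof.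
move=> a x y; rewrite -[a *: x + y]/(tens_add (tens_scale a x) y).
rewrite -{1}(tens_classK x) -{1}(tens_classK y) tens_scaleE tens_addE /tsum.
rewrite (tsum_rel (tens_class_repr _)) big_cat /scale_seq big_map /=.
by congr (_ + _); rewrite scaler_sumr; apply: eq_bigr => p _; rewrite fZl.
Qed.

End Universal.

Lemma tensor_ext (W : lmodType K) (f g : {linear tensor -> W}) :
  (forall u v, f (tens u v) = g (tens u v)) -> f =1 g.
Proof.
move=> fg x; rewrite (tens_sum x) !linear_sum.
by apply: eq_bigr => p _; rewrite fg.
Qed.

End Tensor.

Arguments tens {K U V}.

Section TensorMaps.
Variable K : fieldType.

Lemma tens_comp_bilinear (U V U' V' : lmodType K)
    (f : {linear U -> U'}) (g : {linear V -> V'}) :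
  bilinear_map (fun u v => tens (f u) (g v)).
Proof.
by split=> [v a u u'|u a v v']; rewrite /= linearP; apply tens_bilinear.
Qed.

Definition tmap (U V U' V' : lmodType K)
  (f : {linear U -> U'}) (g : {linear V -> V'}) : tensor U V -> tensor U' V' :=
  tsum (fun u v => tens (f u) (g v)).
HB.instance Definition _ U V U' V' f g :=
  GRing.isLinear.Build K _ _ _ (@tmap U V U' V' f g)
    (tsum_linear (tens_comp_bilinear f g)).

Lemma tmapE (U V U' V' : lmodType K)
    (f : {linear U -> U'}) (g : {linear V -> V'}) u v :
  tmap f g (tens u v) = tens (f u) (g v).
Proof. exact: (tsumE (tens_comp_bilinear f g)). Qed.

Section Assoc.
Variables U V W : lmodType K.

Let assoc_inner (u : U) : tensor V W -> tensor (tensor U V) W :=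
  tsum (fun v w => tens (tens u v) w).

Let assoc_inner_bilinear (u : U) :
  bilinear_map (fun (v : V) (w : W) => tens (tens u v) w).
Proof.
split=> [w a v v'|v a w w'] /=; last exact: (tens_bilinear _ _).2.
by rewrite (tens_bilinear _ _).2; exact: (tens_bilinear _ _).1.
Qed.

Let assoc_bilinear : bilinear_map assoc_inner.
Proof.
split=> [x a u u'|u]; last exact: tsum_linear (assoc_inner_bilinear u).
rewrite /= /assoc_inner /tsum scaler_sumr -big_split; apply: eq_bigr => p _ /=.
by rewrite (tens_bilinear _ _).1; exact: (tens_bilinear _ _).1.
Qed.

Definition tassoc : tensor U (tensor V W) -> tensor (tensor U V) W :=
  tsum (fun u => tsum (fun v w => tens (tens u v) w)).
HB.instance Definition _ :=
  GRing.isLinear.Build K _ _ _ tassoc (tsum_linear assoc_bilinear).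

Lemma tassocE u v w : tassoc (tens u (tens v w)) = tens (tens u v) w.
Proof.
by rewrite /tassoc (tsumE assoc_bilinear) /assoc_inner (tsumE (assoc_inner_bilinear _)).
Qed.

End Assoc.

Section Product.
Variable A : algType K.

Lemma mul_bilinear : bilinear_map ( *%R : A -> A -> A).
Proof.
by split=> [b c a a'|a c b b'] /=; rewrite ?mulrDl ?mulrDr -?scalerAl -?scalerAr.
Qed.

Definition mu : tensor A A -> A := tsum *%R.
HB.instance Definition _ :=
  GRing.isLinear.Build K _ _ _ mu (tsum_linear mul_bilinear).

Lemma muE a b : mu (tens a b) = a * b.
Proof. exact: (tsumE mul_bilinear). Qed.

(* The product of the algebra A (x) A. *)
Definition tmul (x y : tensor A A) : tensor A A :=
  tsum (fun a b => tsum (fun c d => tens (a * c) (b * d)) y) x.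

Lemma tmulE a b c d : tmul (tens a b) (tens c d) = tens (a * c) (b * d).
Proof.
have bi x y : bilinear_map (fun c d : A => tens (x * c) (y * d)).
  split=> [v e u u'|u e v v'] /=; rewrite mulrDr -scalerAr.
    exact: (tens_bilinear _ _).1.
  exact: (tens_bilinear _ _).2.
have bo : bilinear_map
    (fun a b => tsum (fun c d => tens (a * c) (b * d)) (tens c d)).
  split=> [v e u u'|u e v v'] /=; rewrite !(tsumE (bi _ _)) mulrDl -scalerAl.
    exact: (tens_bilinear _ _).1.
  exact: (tens_bilinear _ _).2.
by rewrite /tmul (tsumE bo) (tsumE (bi _ _)).
Qed.

End Product.
End TensorMaps.

Arguments tassoc {K} U V W.
Arguments mu {K} A.

(* In the axioms, tsum (fun h1 h2 => E) (Delta h) is the Sweedler sum of E. *)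
Record hopfAlgebra (K : fieldType) := HopfAlgebra {
  hopf_alg :> algType K;
  Delta : {linear hopf_alg -> tensor hopf_alg hopf_alg};
  counit : {scalar hopf_alg};
  antipode : {linear hopf_alg -> hopf_alg};
  Delta_coassoc : forall h,
    tassoc _ _ _ (tmap idfun Delta (Delta h)) = tmap Delta idfun (Delta h);
  Delta_counitl : forall h, tsum (fun h1 h2 => counit h1 *: h2) (Delta h) = h;
  Delta_counitr : forall h, tsum (fun h1 h2 => counit h2 *: h1) (Delta h) = h;
  Delta1 : Delta 1 = tens 1 1;
  DeltaM : forall h k, Delta (h * k) = tmul (Delta h) (Delta k);
  counit1 : counit 1 = 1;
  counitM : forall h k, counit (h * k) = counit h * counit k;
  antipodel : forall h,
    tsum (fun h1 h2 => antipode h1 * h2) (Delta h) = counit h *: 1;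
  antipoder : forall h,
    tsum (fun h1 h2 => h1 * antipode h2) (Delta h) = counit h *: 1
}.

Definition lact (K : fieldType) (A M : lmodType K)
  (lambda : {linear tensor A M -> M}) (h : A) (m : M) : M := lambda (tens h m).

Lemma lact_bilinear (K : fieldType) (A M : lmodType K)
  (lambda : {linear tensor A M -> M}) : bilinear_map (lact lambda).
Proof.
by split=> [v a u u'|u a v v'];
  rewrite /lact /= (tens_bilinear _ _) linearP.
Qed.

Record partialModule (K : fieldType) (H : hopfAlgebra K) := PartialModule {
  pm_space :> lmodType K;
  pm_lambda : {linear tensor H pm_space -> pm_space};
  pm_unit : forall m, lact pm_lambda 1 m = m;
  pm_mull : forall (h k : H) m,
    tsum (fun k1 k2 => lact pm_lambda h
            (lact pm_lambda k1 (lact pm_lambda (antipode H k2) m))) (Delta H k)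
    = tsum (fun k1 k2 => lact pm_lambda (h * k1)
            (lact pm_lambda (antipode H k2) m)) (Delta H k);
  pm_mulr : forall (h k : H) m,
    tsum (fun k1 k2 => lact pm_lambda k1
            (lact pm_lambda (antipode H k2) (lact pm_lambda h m))) (Delta H k)
    = tsum (fun k1 k2 => lact pm_lambda k1
            (lact pm_lambda (antipode H k2 * h) m)) (Delta H k)
}.

Definition act (K : fieldType) (H : hopfAlgebra K) (M : partialModule H) :
  H -> M -> M := lact (pm_lambda M).

Lemma act_linearl (K : fieldType) (H : hopfAlgebra K) (M : partialModule H)
  (a : K) (h h' : H) (m : M) : act (a *: h + h') m = a *: act h m + act h' m.
Proof. exact: (lact_bilinear (pm_lambda M)).1. Qed.

Lemma act_linearr (K : fieldType) (H : hopfAlgebra K) (M : partialModule H)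
  (h : H) (a : K) (m m' : M) : act h (a *: m + m') = a *: act h m + act h m'.
Proof. exact: (lact_bilinear (pm_lambda M)).2. Qed.

Record pm_mor (K : fieldType) (H : hopfAlgebra K) (M N : partialModule H) :=
  PMMor {
    pm_fun :> {linear M -> N};
    pm_funP : forall (h : H) (m : M), pm_fun (act h m) = act h (pm_fun m)
  }.

Lemma pm_mor_eq (K : fieldType) (H : hopfAlgebra K) (M N : partialModule H)
  (f g : pm_mor M N) : f =1 g -> f = g.
Proof.
case: f => f fP; case: g => g gP /= /linear_eq fg; move: fP gP.
by rewrite fg => fP gP; rewrite (Prop_irrelevance fP gP).
Qed.

Definition subspace (K : fieldType) (V : lmodType K) (S : submodClosed V) : Type :=
  {x : V | x \in S}.
HB.instance Definition _ K V S := SubChoice.on (@subspace K V S).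
HB.instance Definition _ K V S := [SubChoice_isSubLmodule of @subspace K V S by <:].

Section Pullback.
Variables (K : fieldType) (U V W : lmodType K).
Variables (f : {linear U -> W}) (g : {linear V -> W}).

Definition pullback_pred : {pred U * V} := [pred p | f p.1 == g p.2].

Lemma pullback_closed : submod_closed pullback_pred.
Proof.
split=> [|a p q]; rewrite !inE /= ?linear0 // => /eqP pP /eqP qP.
by rewrite !linearP pP qP.
Qed.
HB.instance Definition _ :=
  GRing.isSubmodClosed.Build K (U * V)%type pullback_pred pullback_closed.

Definition pullback : lmodType K := subspace pullback_pred.

Definition pb_fst (p : pullback) : U := (val p).1.
Definition pb_snd (p : pullback) : V := (val p).2.

End Pullback.

Section GeometricPartialComodules.
Variables (K : fieldType) (A : algType K).

(* Geometric partial comodules over the coalgebra (A, mu, u) of Vect^op are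
   spelled out in Vect: epimorphisms become injective maps and pushouts become
   pullbacks. *)
Record gpdata := GPData {
  gp_space :> lmodType K;
  gp_bullet : lmodType K;
  gp_pi : {linear gp_bullet -> tensor A gp_space};
  gp_rho : {linear gp_bullet -> gp_space}
}.

(* A . (A . M): pairs (x, y) in (A . M) * (A (x) (A . M)). *)
Definition gp_bullet2 (M : gpdata) : lmodType K :=
  pullback (gp_pi M) (tmap idfun (gp_rho M)).

(* (A . A) . M: pairs (x, y) in (A . M) * (A (x) (A . M)). *)
Definition gp_mu_bullet (M : gpdata) : lmodType K :=
  pullback (gp_pi M)
    (tmap (mu A) idfun \o (tassoc A A M \o tmap idfun (gp_pi M))).

Definition gp_unital (M : gpdata) : Prop :=
  exists u : {linear M -> gp_bullet M},
    (forall m, gp_rho M (u m) = m) /\ (forall m, gp_pi M (u m) = tens 1 m).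

Definition gp_assoc (M : gpdata) : Prop :=
  exists theta : {linear gp_bullet2 M -> gp_mu_bullet M},
    [/\ bijective theta,
        forall p, pb_snd (theta p) = pb_snd p
      & forall p, gp_rho M (pb_fst (theta p)) = gp_rho M (pb_fst p)].

Definition is_gpcomodule (M : gpdata) : Prop :=
  [/\ injective (gp_pi M), gp_unital M & gp_assoc M].

Record gpcomodule := GPComodule {
  gp_data :> gpdata;
  gp_axioms : is_gpcomodule gp_data
}.

Record gp_mor (M N : gpdata) := GPMor {
  gp_fun : {linear M -> N};
  gp_bfun : {linear gp_bullet M -> gp_bullet N};
  gp_morrho : forall x, gp_fun (gp_rho M x) = gp_rho N (gp_bfun x);
  gp_morpi : forall x, tmap idfun gp_fun (gp_pi M x) = gp_pi N (gp_bfun x)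
}.

Lemma gp_mor_eq (M N : gpdata) (f g : gp_mor M N) :
  gp_fun f =1 gp_fun g -> gp_bfun f =1 gp_bfun g -> f = g.
Proof.
case: f => f bf p q; case: g => g bg p' q' /= /linear_eq fg /linear_eq bfg.
move: p q p' q'; rewrite fg bfg => p q p' q'.
by rewrite (Prop_irrelevance p p') (Prop_irrelevance q q').
Qed.

End GeometricPartialComodules.

Record category := Category {
  catObj :> Type;
  catHom : catObj -> catObj -> Type;
  catId : forall X, catHom X X;
  catComp : forall X Y Z, catHom Y Z -> catHom X Y -> catHom X Z;
  catComp_idl : forall X Y (f : catHom X Y), catComp (catId Y) f = f;
  catComp_idr : forall X Y (f : catHom X Y), catComp f (catId X) = f;
  catComp_assoc : forall X Y Z T (h : catHom Z T) (g : catHom Y Z) (f : catHom X Y),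
    catComp h (catComp g f) = catComp (catComp h g) f
}.

Definition opposite (C : category) : category :=
  @Category C (fun X Y => catHom Y X) (fun X => catId X) (fun X Y Z g f => catComp f g)
    (fun X Y f => catComp_idr f) (fun X Y f => catComp_idl f)
    (fun X Y Z T h g f => esym (catComp_assoc f g h)).

Record functor_laws (C D : category) (F0 : C -> D)
    (F1 : forall X Y : C, catHom X Y -> catHom (F0 X) (F0 Y)) : Prop := FunctorLaws {
  functor_id : forall X, F1 X X (catId X) = catId (F0 X);
  functor_comp : forall X Y Z (g : catHom Y Z) (f : catHom X Y),
    F1 X Z (catComp g f) = catComp (F1 Y Z g) (F1 X Y f)
}.

Record functor (C D : category) := Functor {
  fobj :> C -> D;
  fmap : forall X Y : C, catHom X Y -> catHom (fobj X) (fobj Y);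
  fmap_functor : functor_laws fmap
}.

Definition is_faithful (C D : category) (F : functor C D) : Prop :=
  forall X Y : C, injective (@fmap C D F X Y).

Section PMod.
Variables (K : fieldType) (H : hopfAlgebra K).

Definition pm_id (M : partialModule H) : pm_mor M M :=
  @PMMor K H M M idfun (fun _ _ => erefl).

Lemma pm_comp_proof (M N P : partialModule H) (g : pm_mor N P) (f : pm_mor M N)
  (h : H) (m : M) : (g \o f) (act h m) = act h ((g \o f) m).
Proof. by rewrite /= !pm_funP. Qed.

Definition pm_comp (M N P : partialModule H) (g : pm_mor N P) (f : pm_mor M N) :
  pm_mor M P := @PMMor K H M P (g \o f) (pm_comp_proof g f).

Lemma pm_comp_idl M N (f : pm_mor M N) : pm_comp (pm_id N) f = f.
Proof. exact: pm_mor_eq. Qed.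
Lemma pm_comp_idr M N (f : pm_mor M N) : pm_comp f (pm_id M) = f.
Proof. exact: pm_mor_eq. Qed.
Lemma pm_comp_assoc M N P Q (h : pm_mor P Q) (g : pm_mor N P) (f : pm_mor M N) :
  pm_comp h (pm_comp g f) = pm_comp (pm_comp h g) f.
Proof. exact: pm_mor_eq. Qed.

Definition PMod : category := Category pm_comp_idl pm_comp_idr pm_comp_assoc.

End PMod.

Section GPCom.
Variables (K : fieldType) (A : algType K).

Lemma tmap_id (U V : lmodType K) :
  tmap (@idfun U) (@idfun V) =1 idfun.
Proof.
by apply: tensor_ext => u v; rewrite /= tmapE.
Qed.

Lemma tmap_comp (U V V' V'' : lmodType K)
    (g : {linear V' -> V''}) (f : {linear V -> V'}) (x : tensor U V) :
  tmap idfun (g \o f) x = tmap idfun g (tmap idfun f x).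
Proof.
move: x; apply: (tensor_ext (g := tmap idfun g \o tmap idfun f)) => u v /=.
by rewrite !tmapE.
Qed.

Definition gp_id (M : gpdata A) : gp_mor M M :=
  @GPMor K A M M idfun idfun (fun _ => erefl) (fun x => tmap_id (gp_pi M x)).

Section Comp.
Variables (M N P : gpdata A) (g : gp_mor N P) (f : gp_mor M N).

Lemma gp_comp_rho x : (gp_fun g \o gp_fun f) (gp_rho M x)
  = gp_rho P ((gp_bfun g \o gp_bfun f) x).
Proof. by rewrite /= !gp_morrho. Qed.

Lemma gp_comp_pi x : tmap idfun (gp_fun g \o gp_fun f) (gp_pi M x)
  = gp_pi P ((gp_bfun g \o gp_bfun f) x).
Proof. by rewrite tmap_comp !gp_morpi. Qed.

Definition gp_comp : gp_mor M P :=
  @GPMor K A M P (gp_fun g \o gp_fun f) (gp_bfun g \o gp_bfun f)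
    gp_comp_rho gp_comp_pi.

End Comp.

Section Laws.
Variables M N P Q : gpcomodule A.

Lemma gp_comp_idl (f : gp_mor M N) : gp_comp (gp_id N) f = f.
Proof. exact: gp_mor_eq. Qed.
Lemma gp_comp_idr (f : gp_mor M N) : gp_comp f (gp_id M) = f.
Proof. exact: gp_mor_eq. Qed.
Lemma gp_comp_assoc (h : gp_mor P Q) (g : gp_mor N P) (f : gp_mor M N) :
  gp_comp (gp_comp h g) f = gp_comp h (gp_comp g f).
Proof. exact: gp_mor_eq. Qed.

End Laws.

(* Morphisms from M to N are pairs of arrows from M to N in Vect^op, that is,
   pairs of linear maps from N to M. *)
Definition gPCom : category :=
  @Category (gpcomodule A) (fun M N => gp_mor N M) (fun M => gp_id M)
    (fun M N P g f => gp_comp f g)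
    (fun M N => @gp_comp_idr N M) (fun M N => @gp_comp_idl N M)
    (fun M N P Q h g f => gp_comp_assoc f g h).

End GPCom.

Section Bullet.
Variables (K : fieldType) (H : hopfAlgebra K) (M : partialModule H).

Definition bullet_pred : {pred tensor H M} := fun x => `[< forall k : H,
  tsum (fun h m => act k (act h m)) x = tsum (fun h m => act (k * h) m) x >].

Lemma bullet_closed : submod_closed bullet_pred.
Proof.
have b1 k : bilinear_map (fun (h : H) (m : M) => act k (act h m)).
  by split=> [v a u u'|u a v v'] /=; rewrite ?act_linearl !act_linearr.
have b2 k : bilinear_map (fun (h : H) (m : M) => act (k * h) m).
  split=> [v a u u'|u a v v'] /=; last by rewrite act_linearr.
  by rewrite mulrDr -scalerAr act_linearl.
pose L1 k : {linear tensor H M -> M} :=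
  HB.pack (tsum _) (GRing.isLinear.Build K _ _ _ _ (tsum_linear (b1 k))).
pose L2 k : {linear tensor H M -> M} :=
  HB.pack (tsum _) (GRing.isLinear.Build K _ _ _ _ (tsum_linear (b2 k))).
have LP x : reflect (forall k, L1 k x = L2 k x) (x \in bullet_pred).
  exact: asboolP.
split=> [|a x y /LP xP /LP yP]; apply/LP=> k; first by rewrite !linear0.
by rewrite !linearP xP yP.
Qed.
HB.instance Definition _ :=
  GRing.isSubmodClosed.Build K (tensor H M) bullet_pred bullet_closed.

Definition bullet : lmodType K := subspace bullet_pred.

Definition bullet_pi : bullet -> tensor H M := val.
HB.instance Definition _ := GRing.Linear.on bullet_pi.

Definition bullet_rho : bullet -> M := pm_lambda M \o bullet_pi.
HB.instance Definition _ := GRing.Linear.on bullet_rho.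

Definition bullet_data : gpdata H := GPData bullet_pi bullet_rho.

End Bullet.

Arguments bullet_pred {K H} M.

(* Main.v *)
Require Import Defs.
From HB Require Import structures.
From mathcomp Require Import all_boot all_order all_algebra.
From mathcomp Require Import boolp.

Set Implicit Arguments.
Unset Strict Implicit.
Unset Printing Implicit Defensive.

Import GRing.Theory.
Local Open Scope ring_scope.

(** Write [l.x] for the left translate of [x] in [H (x) M] by [l] on the factor
    [H], and [lambda] for the action.  A tensor [x] belongs to [H . M] exactly
    when [l . lambda x = lambda (l.x)] for all [l] ([bullet_predP]), so
    membership depends only on the family of values [lambda (l.x)].

    Both double pullbacks are determined by their component
    [y = sum h (x) z] in [H (x) (H . M)]: the first consists of the [y] for
    which [act_inner y = sum h (x) rho z] lies in [H . M], the second of those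
    for which [mul_outer y = sum h.z] does.  As [z] is in [H . M],
    [lambda (l.(h (x) rho z)) = (l h) . rho z = lambda ((l h).z)
    = lambda (l.(h.z))], that is, the two tensors have the same family of
    values ([lambda_translate_nested]).  Hence the two conditions on [y] are
    equivalent, and [l = 1] shows that both tensors have the same image in
    [M].  Geometric associativity is therefore realised by the isomorphism
    that is the identity on [y] ([bullet_assoc]).  The unit is
    [m |-> 1 (x) m], by [1 . m = m].

    A morphism [f] commutes with the actions and [H (x) f] commutes with
    translations, so [H (x) f] restricts to a map between the spaces [H . M]
    ([tmap_bullet]); functoriality is checked after the injective inclusions
    into the tensor products.  Faithfulness holds because [f] itself is the
    first component of its image. *)

(** * Linear maps into tensor products, subspaces and pullbacks *)

Section TensorRight.
Variables (K : fieldType) (U V : lmodType K) (u : U).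

Lemma tens_linear : linear (@tens K U V u).
Proof. exact: (tens_bilinear _ _).2. Qed.
HB.instance Definition _ :=
  GRing.isLinear.Build K V (tensor U V) _ (@tens K U V u) tens_linear.

End TensorRight.

Section Corestriction.
Variables (K : fieldType) (U V : lmodType K) (S : submodClosed V).
Variables (f : {linear U -> V}) (fS : forall u, f u \in S).

Definition corestr (u : U) : subspace S := exist _ (f u) (fS u).

Lemma corestr_linear : linear corestr.
Proof. by move=> a u v; apply: val_inj; rewrite /= linearP. Qed.
HB.instance Definition _ := GRing.isLinear.Build K _ _ _ corestr corestr_linear.

End Corestriction.

Section PullbackMaps.
Variables (K : fieldType) (U V W : lmodType K).
Variables (f : {linear U -> W}) (g : {linear V -> W}).

Lemma pb_snd_linear : linear (@pb_snd K U V W f g).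
Proof. by []. Qed.
HB.instance Definition _ :=
  GRing.isLinear.Build K _ _ _ (@pb_snd K U V W f g) pb_snd_linear.

Lemma pb_commute (p : pullback f g) : f (pb_fst p) = g (pb_snd p).
Proof. exact/eqP/(valP p). Qed.

Lemma pb_eq (p q : pullback f g) :
  pb_fst p = pb_fst q -> pb_snd p = pb_snd q -> p = q.
Proof.
rewrite /pb_fst /pb_snd => e1 e2; apply: val_inj.
by case: (val p) (val q) e1 e2 => [a b] [c d] /= -> ->.
Qed.

Section Universal.
Variables (X : lmodType K) (a : {linear X -> U}) (b : {linear X -> V}).
Hypothesis ab : forall x, f (a x) = g (b x).

Definition pb_pair (x : X) : pullback f g :=
  exist _ (a x, b x) (introT eqP (ab x)).

Lemma pb_pair_linear : linear pb_pair.
Proof. by move=> c x y; apply: pb_eq; rewrite /= [LHS]linearP. Qed.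
HB.instance Definition _ := GRing.isLinear.Build K _ _ _ pb_pair pb_pair_linear.

End Universal.
End PullbackMaps.

(** * The space [H . M] *)

Section Bullet.
Variables (K : fieldType) (H : hopfAlgebra K) (M : partialModule H).

Definition translate (l : H) : {linear tensor H M -> tensor H M} :=
  tmap (l \*o idfun) idfun.

Lemma translateE l h m : translate l (tens h m) = tens (l * h) m.
Proof. exact: tmapE. Qed.

Lemma translate1 x : translate 1 x = x.
Proof.
by move: x; apply: (tensor_ext (g := idfun)) => h m; rewrite translateE mul1r.
Qed.

Lemma translateM l h x : translate l (translate h x) = translate (l * h) x.
Proof.
move: x; apply: (tensor_ext (f := translate l \o translate h)) => k m /=.
by rewrite !translateE mulrA.
Qed.

HB.instance Definition _ (l : H) :=
  GRing.isLinear.Build K M M _ (@act K H M l) (act_linearr l).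

(** The two sums defining [H . M] are values of [lambda]; in this form the
    condition sees [x] only through the family [lambda (l.x)]. *)
Lemma bullet_predP x :
  reflect (forall l, act l (pm_lambda M x) = pm_lambda M (translate l x))
    (x \in bullet_pred M).
Proof.
have actE l : tsum (fun h m => act l (act h m)) x = act l (pm_lambda M x).
  by rewrite [in RHS](tens_sum x) !linear_sum.
have mulE l :
    tsum (fun h m => act (l * h) m) x = pm_lambda M (translate l x).
  rewrite [in RHS](tens_sum x) (linear_sum (translate l)) linear_sum.
  by apply: eq_bigr => p _; rewrite translateE.
by apply: (iffP (asboolP _)) => xM l; move: (xM l); rewrite actE mulE.
Qed.

Lemma act_bullet_rho l (z : bullet M) :
  act l (bullet_rho z) = pm_lambda M (translate l (bullet_pi z)).
Proof. exact: (bullet_predP _ (valP z)). Qed.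

Lemma bullet_pi_inj : injective (@bullet_pi K H M).
Proof. exact: val_inj. Qed.

(** ** Unitality *)

Lemma tens1_bullet m : tens 1 m \in bullet_pred M.
Proof.
apply/bullet_predP => l; rewrite translateE mulr1.
by congr (act l _); exact: pm_unit.
Qed.

Lemma bullet_unital : gp_unital (bullet_data M).
Proof.
exists (corestr (f := @tens K H M 1) tens1_bullet).
by split=> // m; exact: pm_unit.
Qed.

(** ** Geometric associativity *)

(** The maps along which [pi] is pulled back to give [H . (H . M)] and
    [(H . H) . M]; [act_inner] acts with the inner factor on [M], and
    [mul_outer] multiplies it by the outer one. *)
Let act_inner : {linear tensor H (bullet M) -> tensor H M} :=
  tmap idfun (@bullet_rho K H M).
Let mul_outer : {linear tensor H (bullet M) -> tensor H M} :=
  tmap (mu H) idfun \o (tassoc H H M \o tmap idfun (@bullet_pi K H M)).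

Lemma mu_tassoc_tens h x :
  tmap (mu H) idfun (tassoc H H M (tens h x)) = translate h x.
Proof.
move: x; apply: (tensor_ext
  (f := tmap (mu H) idfun \o (tassoc H H M \o tens h))) => k m /=.
by rewrite tassocE tmapE translateE -[in RHS]muE.
Qed.

(** This is where the elements of [H . M] nested inside [y] are used: on
    [h (x) z] both sides equal [(l h) . rho z], because [z] is in [H . M]. *)
Lemma lambda_translate_nested l y :
  pm_lambda M (translate l (act_inner y))
  = pm_lambda M (translate l (mul_outer y)).
Proof.
move: y; apply: (tensor_ext
  (f := pm_lambda M \o translate l \o act_inner)
  (g := pm_lambda M \o translate l \o mul_outer)) => h z.
have actE : act_inner (tens h z) = tens h (bullet_rho z) by exact: tmapE.
have mulE : mul_outer (tens h z) = translate h (bullet_pi z).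
  by rewrite /mul_outer /= tmapE mu_tassoc_tens.
rewrite -[LHS]/(pm_lambda M (translate l (act_inner _))).
rewrite -[RHS]/(pm_lambda M (translate l (mul_outer _))).
rewrite actE mulE translateE translateM; exact: act_bullet_rho.
Qed.

Lemma lambda_nested y : pm_lambda M (act_inner y) = pm_lambda M (mul_outer y).
Proof. by have := lambda_translate_nested 1 y; rewrite !translate1. Qed.

(** The two pullback conditions agree, by the characterisation of [H . M]
    through the values on translates. *)
Lemma bullet_nested y :
  (act_inner y \in bullet_pred M) = (mul_outer y \in bullet_pred M).
Proof.
apply/bullet_predP/bullet_predP => yM l; move: (yM l);
  by rewrite lambda_nested lambda_translate_nested.
Qed.

Lemma mul_outer_bullet (p : gp_bullet2 (bullet_data M)) :
  mul_outer (pb_snd p) \in bullet_pred M.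
Proof. by rewrite -bullet_nested -[act_inner _]pb_commute; exact: valP. Qed.

Lemma act_inner_bullet (p : gp_mu_bullet (bullet_data M)) :
  act_inner (pb_snd p) \in bullet_pred M.
Proof. by rewrite bullet_nested -[mul_outer _]pb_commute; exact: valP. Qed.

(** Since [pi] is injective, the component in [H . M] of a point of either
    pullback is recovered from the component in [H (x) (H . M)]; [theta]
    keeps the latter and recomputes the former. *)
Lemma bullet_assoc : gp_assoc (bullet_data M).
Proof.
pose theta : {linear gp_bullet2 (bullet_data M) ->
    gp_mu_bullet (bullet_data M)} :=
  @pb_pair _ _ _ _ (gp_pi (bullet_data M)) mul_outer _
    (corestr (f := mul_outer \o @pb_snd _ _ _ _ _ _) mul_outer_bullet)
    (@pb_snd _ _ _ _ _ _) (fun => erefl).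
pose eta : {linear gp_mu_bullet (bullet_data M) ->
    gp_bullet2 (bullet_data M)} :=
  @pb_pair _ _ _ _ (gp_pi (bullet_data M)) act_inner _
    (corestr (f := act_inner \o @pb_snd _ _ _ _ _ _) act_inner_bullet)
    (@pb_snd _ _ _ _ _ _) (fun => erefl).
exists theta; split=> // [|p].
  by exists eta => p; apply: pb_eq => //; apply: bullet_pi_inj;
    rewrite [RHS]pb_commute.
change (pm_lambda M (mul_outer (pb_snd p))
  = pm_lambda M (bullet_pi (pb_fst p))).
by rewrite -lambda_nested [in RHS]pb_commute.
Qed.

Lemma bullet_gpcomodule : is_gpcomodule (bullet_data M).
Proof.
split; [exact: bullet_pi_inj | exact: bullet_unital | exact: bullet_assoc].
Qed.

End Bullet.

Arguments translate {K H M}.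

(** * The functor *)

Section BulletMorphism.
Variables (K : fieldType) (H : hopfAlgebra K) (M N : partialModule H).
Variable f : pm_mor M N.

Lemma pm_lambda_tmap x : f (pm_lambda M x) = pm_lambda N (tmap idfun f x).
Proof.
move: x; apply: (tensor_ext (f := pm_fun f \o pm_lambda M)
                            (g := pm_lambda N \o tmap idfun f)) => h m /=.
by rewrite tmapE; exact: pm_funP.
Qed.

Lemma translate_tmap l x :
  translate l (tmap idfun f x) = tmap idfun f (translate l x).
Proof.
move: x; apply: (tensor_ext (f := translate l \o tmap idfun f)
                            (g := tmap idfun f \o translate l)) => h m /=.
by rewrite !(translateE, tmapE).
Qed.

(** [f] is equivariant, so it carries the equations
    [l . lambda x = lambda (l.x)] to those for [(H (x) f) x]. *)
Lemma tmap_bullet (x : bullet M) : tmap idfun f (bullet_pi x) \in bullet_pred N.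
Proof.
apply/bullet_predP => l.
by rewrite translate_tmap -!pm_lambda_tmap -pm_funP -act_bullet_rho.
Qed.

Definition bullet_map : {linear bullet M -> bullet N} :=
  corestr (f := tmap idfun f \o @bullet_pi K H M) tmap_bullet.

Lemma bullet_map_rho (x : bullet M) :
  f (bullet_rho x) = bullet_rho (bullet_map x).
Proof. exact: pm_lambda_tmap. Qed.

Definition bullet_mor : gp_mor (bullet_data M) (bullet_data N) :=
  @GPMor K H (bullet_data M) (bullet_data N) f bullet_map bullet_map_rho
    (fun => erefl).

End BulletMorphism.

Theorem proposition3p11 (K : fieldType) (H : hopfAlgebra K) :
  exists gp : forall M : partialModule H, is_gpcomodule (bullet_data M),
  let Pobj : PMod H -> opposite (gPCom H) := fun M => GPComodule (gp M) in
  exists Pmap : forall M N : PMod H, catHom M N -> catHom (Pobj M) (Pobj N),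
  exists Pfun : functor_laws Pmap,
    (forall (M N : partialModule H) (f : pm_mor M N),
        gp_fun (Pmap M N f) = pm_fun f /\
        forall x : bullet M,
          bullet_pi (gp_bfun (Pmap M N f) x) = tmap idfun f (bullet_pi x)) /\
    is_faithful (Functor Pfun).
Proof.
exists (@bullet_gpcomodule K H) => Pobj.
exists (@bullet_mor K H).
have Pfun : @functor_laws (PMod H) (opposite (gPCom H)) Pobj (@bullet_mor K H).
  split=> [M | M N P g f]; apply: gp_mor_eq => // x; apply: bullet_pi_inj.
    exact: tmap_id.
  exact: tmap_comp.
exists Pfun; split=> // M N f g fg.
have fg' : bullet_mor f = bullet_mor g := fg.
by apply: pm_mor_eq => m; rewrite -[f m]/(gp_fun (bullet_mor f) m) fg'.
Qed.
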